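(* Let $\Gamma$ be a finite group and let $G_\Gamma$ be the associated Frucht graph (for any enumeration of $\Gamma$ and any admissible choice of the numbers $m(i,j)$). Then $G_\Gamma$ has no quantum symmetry.
   Context: Graphs are finite, undirected, without loops or parallel edges. For a graph $G$, $C(\mathrm{Qut}(G))$ is the universal unital $C^*$-algebra with generators $u_{ij}$, $i,j\in V(G)$, and relations: $u_{ij}=u_{ij}^*=u_{ij}^2$; $\sum_l u_{il}=1=\sum_l u_{li}$; $u_{ij}u_{kl}=0$ whenever exactly one of $(i,k)\in E(G)$, $(j,l)\in E(G)$ holds. $G$ has no quantum symmetry if its classical and quantum automorphism groups coincide, i.e. if $C(\mathrm{Qut}(G))$ is commutative. Frucht graph $G_\Gamma$: let $\Gamma$ be a finite group of order $n\ge3$ with labelled elements $g_1,\dots,g_n$. For $i,j\in[n]$, $i\ne j$, let $m(i,j)\in\mathbb{N}$, $m(i,j)\ge2$, be such that $m(i,j)=m(s,t)$ if and only if $g_ig_j^{-1}=g_sg_t^{-1}$. The graph $G_\Gamma$ has vertices $p_i$ ($i\in[n]$), $q_{ijk}$ and $r_{ijl}$ for $i,j\in[n]$ with $i\neq j$, $k\in[2m(i,j)-2]$ and $l\in[2m(i,j)-1]$. Adjacencies (and no others): for $i\ne j$, $p_i\sim q_{ij1}$, $p_i\sim r_{ji1}$, $q_{ij1}\sim r_{ij1}$, $q_{ijk}\sim q_{ij(k-1)}$ for $2\le k\le 2m(i,j)-2$, and $r_{ijl}\sim r_{ij(l-1)}$ for $2\le l\le 2m(i,j)-1$. If $\Gamma$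 has order $1$ or $2$, then $G_\Gamma$ is the complete graph $K_1$ or $K_2$, respectively. *)

(* Defs.v *)
From HB Require Import structures.
From mathcomp Require Import all_boot all_order all_fingroup all_algebra.
From mathcomp Require Import complex.
From mathcomp Require Import all_reals.

Set Implicit Arguments.
Unset Strict Implicit.
Unset Printing Implicit Defensive.

Import Order.TTheory GRing.Theory Num.Theory.
Import ComplexField.Normc.
Local Open Scope ring_scope.
Local Open Scope complex_scope.

(* The joint structure of a GRing.Algebra and a CompleteNormedModule cannot be
   declared in the hierarchy (no common join of rings and normed modules), so
   the real-valued norm and its completeness are spelled out.
   [GRing.Algebra] asks 1 != 0: the zero algebra is not a C*-algebra here. *)
HB.mixin Record isCStar (R : realType) A & GRing.Algebra R[i] A := {
  star : A -> A;
  starK : involutive star;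
  starD : {morph star : a b / a + b};
  starZ : forall (c : R[i]) (a : A), star (c *: a) = c^* *: star a;
  starM : forall a b : A, star (a * b) = star b * star a;
  cnorm : A -> R;
  cnormD_le : forall a b : A, cnorm (a + b) <= cnorm a + cnorm b;
  cnormZ : forall (c : R[i]) (a : A), cnorm (c *: a) = normc c * cnorm a;
  cnorm_eq0 : forall a : A, cnorm a = 0 -> a = 0;
  cnormM_le : forall a b : A, cnorm (a * b) <= cnorm a * cnorm b;
  cnorm_starM : forall a : A, cnorm (star a * a) = cnorm a ^+ 2;
  cnorm_complete : forall x : nat -> A,
    (forall e : R, 0 < e -> exists N : nat, forall p q : nat,
       (N <= p)%N -> (N <= q)%N -> cnorm (x p - x q) < e) ->
    exists l : A, forall e : R, 0 < e -> exists N : nat, forall p : nat,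
       (N <= p)%N -> cnorm (x p - l) < e
}.

#[short(type="cstarAlgType")]
HB.structure Definition CStarAlgebra (R : realType) :=
  { A of GRing.Algebra R[i] A & isCStar R A }.

(* Unital *-homomorphisms are the algebra morphisms satisfying [star_morph];
   such maps are automatically contractive. *)
Definition star_morph (R : realType) (A B : cstarAlgType R) (f : A -> B) :=
  forall a : A, f (star a) = star (f a).

Record sgraph := SGraph {
  vertex :> finType;
  edge : rel vertex;
  edge_sym : symmetric edge;
  edge_irr : irreflexive edge
}.

Definition qut_relations (R : realType) (G : sgraph) (A : cstarAlgType R)
    (u : G -> G -> A) : Prop :=
  [/\ forall i j, u i j = star (u i j) /\ u i j = u i j ^+ 2,
      forall i, \sum_l u i l = 1 /\ \sum_l u l i = 1
    & forall i j k l, edge i k != edge j l -> u i j * u k l = 0].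

Definition qut_hom (R : realType) (G : sgraph) (A B : cstarAlgType R)
    (u : G -> G -> A) (v : G -> G -> B) (f : A -> B) : Prop :=
  star_morph f /\ forall i j, f (u i j) = v i j.

(* The pair (A, u) is C(Qut(G)) with its generators. *)
Definition is_CQut (R : realType) (G : sgraph) (A : cstarAlgType R)
    (u : G -> G -> A) : Prop :=
  qut_relations u /\
  forall (B : cstarAlgType R) (v : G -> G -> B), qut_relations v ->
    exists2 f : {lrmorphism A -> B}, qut_hom u v f
      & forall f' : {lrmorphism A -> B}, qut_hom u v f' -> f' =1 f.

(* C(Qut(G)) is only determined up to isomorphism; by
   [no_quantum_symmetryP] the choice of (A, u) is irrelevant. *)
Definition no_quantum_symmetry (R : realType) (G : sgraph) : Prop :=
  exists (A : cstarAlgType R) (u : G -> G -> A),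
    is_CQut u /\ (forall a b : A, a * b = b * a).

Lemma no_quantum_symmetryP (R : realType) (G : sgraph) :
  no_quantum_symmetry R G <->
  (exists (A : cstarAlgType R) (u : G -> G -> A), is_CQut u) /\
  (forall (A : cstarAlgType R) (u : G -> G -> A), is_CQut u ->
     forall a b : A, a * b = b * a).
Proof.
split=> [[A [u [Au cA]]]|[[A [u Au]] cA]]; last first.
  by exists A, u; split => //; exact: cA Au.
split=> [|B v Bv a b]; first by exists A, u.
have [f [fs fu] _] := Bv.2 A u Au.1; have [g [gs gv] _] := Au.2 B v Bv.1.
have [h _ hP] := Bv.2 B v Bv.1.
have gfK c : g (f c) = c.
  have -> : g (f c) = h c.
    apply: (hP (g \o f : {lrmorphism B -> B})); split=> [x|i j] /=.
      by rewrite fs gs.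
    by rewrite fu gv.
  by apply/esym; apply: (hP (idfun : {lrmorphism B -> B})); split.
by rewrite -[a * b]gfK -[b * a]gfK (rmorphM f a) (rmorphM f b) cA.
Qed.

Definition complete_edge (T : finType) : rel T := [rel x y | x != y].

Lemma complete_edge_sym (T : finType) : symmetric (@complete_edge T).
Proof. by move=> x y; rewrite /complete_edge /= eq_sym. Qed.

Lemma complete_edge_irr (T : finType) : irreflexive (@complete_edge T).
Proof. by move=> x; rewrite /complete_edge /= eqxx. Qed.

Definition complete_graph (n : nat) : sgraph :=
  SGraph (@complete_edge_sym 'I_n) (@complete_edge_irr 'I_n).

Section Frucht.
Variables (n : nat) (m : 'I_n -> 'I_n -> nat).

Definition offdiag := {e : 'I_n * 'I_n | e.1 != e.2}.
Definition src (e : offdiag) : 'I_n := (val e).1.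
Definition tgt (e : offdiag) : 'I_n := (val e).2.
Definition mval (e : offdiag) : nat := m (src e) (tgt e).

(* Positions on the attached paths are counted from 0: for e = (i, j), the
   vertices q_{ijk} and r_{ijl} are [Fq e (k-1)] and [Fr e (l-1)]. *)
Inductive frucht_vertex :=
| Fp of 'I_n
| Fq (e : offdiag) of 'I_(2 * mval e - 2)
| Fr (e : offdiag) of 'I_(2 * mval e - 1).

Arguments Fq : clear implicits.
Arguments Fr : clear implicits.

Definition frucht_code : Type :=
  'I_n + {e : offdiag & 'I_(2 * mval e - 2)}
       + {e : offdiag & 'I_(2 * mval e - 1)}.

Definition frucht_encode (x : frucht_vertex) : frucht_code :=
  match x with
  | Fp i => inl (inl i)
  | Fq e k => inl (inr (existT _ e k))
  | Fr e l => inr (existT _ e l)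
  end.

Definition frucht_decode (c : frucht_code) : frucht_vertex :=
  match c with
  | inl (inl i) => Fp i
  | inl (inr (existT e k)) => Fq e k
  | inr (existT e l) => Fr e l
  end.

Lemma frucht_encodeK : cancel frucht_encode frucht_decode.
Proof. by case. Qed.

HB.instance Definition _ : Finite frucht_vertex :=
  Finite.copy frucht_vertex (can_type frucht_encodeK).

(* Each adjacency in one direction only; [frucht_edge] symmetrizes. *)
Definition frucht_arc (x y : frucht_vertex) : bool :=
  match x, y with
  | Fp i, Fq e k => (i == src e) && (k == 0%N :> nat)
  | Fp i, Fr e l => (i == tgt e) && (l == 0%N :> nat)
  | Fq e k, Fr e' l => [&& e == e', k == 0%N :> nat & l == 0%N :> nat]
  | Fq e k, Fq e' k' => (e == e') && (k' == k.+1 :> nat)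
  | Fr e l, Fr e' l' => (e == e') && (l' == l.+1 :> nat)
  | _, _ => false
  end.

Definition frucht_edge : rel frucht_vertex :=
  [rel x y | frucht_arc x y || frucht_arc y x].

Lemma frucht_edge_sym : symmetric frucht_edge.
Proof. by move=> x y; rewrite /frucht_edge /= orbC. Qed.

Lemma frucht_edge_irr : irreflexive frucht_edge.
Proof.
by case=> [i|e k|e l]; rewrite /frucht_edge /= ?orbb ?eqxx ?ltn_eqF.
Qed.

Definition frucht_graph : sgraph :=
  if (n <= 2)%N then complete_graph n
  else SGraph frucht_edge_sym frucht_edge_irr.

End Frucht.

Arguments Fp {n m} i.
Arguments Fq {n m} e k.
Arguments Fr {n m} e l.

Definition frucht_admissible (gT : finGroupType) (n : nat) (g : 'I_n -> gT)
    (m : 'I_n -> 'I_n -> nat) : Prop :=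
  (forall i j, i != j -> (2 <= m i j)%N) /\
  (forall i j s t, i != j -> s != t ->
     m i j = m s t <-> (g i * (g j)^-1 = g s * (g t)^-1)%g).

(* Main.v *)
Require Import Defs.
From HB Require Import structures.
From mathcomp Require Import all_boot all_order all_fingroup all_algebra.
From mathcomp Require Import complex ring lra zify.
From mathcomp Require Import all_reals.
From mathcomp Require Import classical_sets topology normedtype.

(** Let [v] be a family satisfying the relations of C(Qut(G)) in a C*-algebra.

   Projections that sum to 1 in a C*-algebra are pairwise orthogonal
   ([proj_sum1_orthogonal]), so entries of [v] in a common row or column have
   product 0. An elementary argument suffices: compressed to one of the
   projections e, the others become elements a_i with sum 0 that lie within
   distance 1 of e, so a multiple t of any of them satisfies |e + t| <= 1 and
   |e - t| <= 1. Such a t is 0, as e is an extreme point of the unit ball of its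
   corner ([straddles_eq0]).

   Colour refinement applies to [v]: by the row and column sums, [v x y] vanishes
   as soon as x and y have different degrees ([qut_degree]), or x has a neighbour
   that cannot be sent to any neighbour of y ([qut_refine]). In the Frucht graph
   of a group of order at least 3 this yields that [v x y] = 0 unless x and y
   have the same degree and, on an attached path, the same distance to the free
   end of that path ([frucht_colour]). For this colouring the neighbours of any
   vertex have distinct colours ([coloured_neighbour_unique]).

   The group acts freely on the graph by right translation, preserving colours.
   For an edge x ~ y, orthogonality and the uniqueness of coloured neighbours
   force [v x (act h x)] = [v y (act h y)] for all h ([qut_propagate]); as the graph is
   connected, this projection depends on h alone. Thus [v] consists of sums of
   #|gT| orthogonal projections w_h with sum 1, and these are the same thing as
   a unital *-homomorphism from the algebra of functions on the group. That
   commutative algebra, generated by the indicator functions of the sets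
   {h | act h x = y}, is therefore C(Qut(G))
   ([no_quantum_symmetry_of_free_action]).

   When the group has at most two elements, the fact that rows and columns sum
   to 1 already gives that [v x (act h x)] depends on h alone. *)

Set Implicit Arguments.
Unset Strict Implicit.
Unset Printing Implicit Defensive.

Import Order.TTheory GRing.Theory Num.Theory.
Import ComplexField.Normc numFieldNormedType.Exports.
Local Open Scope ring_scope.

(** * C*-algebras: norm and involution *)

Section CStarBasics.
Variables (R : realType) (B : cstarAlgType R).
Implicit Types a b e p t : B.
Local Notation N := (@cnorm R B).
Local Notation star := (@star R B).

Lemma normc_ge0 (c : R[i]) : 0 <= normc c.
Proof. by case: c => x y; apply: sqrtr_ge0. Qed.

Lemma normc_real (x : R) : 0 <= x -> normc (real_complex R x) = x.
Proof. by move=> x0; rewrite /normc /= expr0n addr0 sqrtr_sqr ger0_norm. Qed.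

Lemma normc_nat n : normc (n%:R : R[i]) = n%:R.
Proof. by rewrite -(rmorph_nat (real_complex R)) normc_real ?ler0n. Qed.

Lemma cnormMn a n : N (a *+ n) = n%:R * N a.
Proof. by rewrite -scaler_nat cnormZ normc_nat. Qed.

Lemma cnorm0 : N 0 = 0.
Proof. by rewrite -(mulr0n (0 : B)) cnormMn mul0r. Qed.

Lemma cnormN a : N (- a) = N a.
Proof.
rewrite -scaleN1r cnormZ -(rmorph1 (real_complex R)) -(rmorphN (real_complex R)).
by rewrite /normc /= expr0n addr0 sqrtr_sqr normrN1 mul1r.
Qed.

Lemma cnormB_le a b : N (a - b) <= N a + N b.
Proof. by rewrite -(cnormN b) cnormD_le. Qed.

Lemma cnorm_ge0 a : 0 <= N a.
Proof. by have := cnormB_le a a; rewrite subrr cnorm0 -mulr2n pmulrn_lge0. Qed.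

Lemma cnorm_sum (I : finType) (P : pred I) (F : I -> B) :
  N (\sum_(i | P i) F i) <= \sum_(i | P i) N (F i).
Proof.
elim/big_ind2: _ => [|x1 x2 y1 y2 h1 h2|//]; first by rewrite cnorm0.
by apply: le_trans (cnormD_le _ _) _; apply: lerD.
Qed.

Lemma star0 : star 0 = 0.
Proof. by apply: (addrI (star 0)); rewrite -starD !addr0. Qed.

Lemma starN a : star (- a) = - star a.
Proof. by apply: (addrI (star a)); rewrite -starD !subrr star0. Qed.

Lemma star_sum (I : finType) (P : pred I) (F : I -> B) :
  star (\sum_(i | P i) F i) = \sum_(i | P i) star (F i).
Proof. exact: (big_morph star (@starD R B) star0). Qed.

Lemma cnorm_star_mul_eq0 a : star a * a = 0 -> a = 0.
Proof.
move=> h; apply: cnorm_eq0; apply/eqP; rewrite -sqrf_eq0.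
by rewrite -cnorm_starM h cnorm0.
Qed.

Definition is_proj p := star p = p /\ p * p = p.

Lemma cnorm_proj p : is_proj p -> N p <= 1.
Proof.
move=> [sp pp]; have := cnorm_starM p; rewrite sp pp => h.
have : N p * (N p - 1) = 0 by rewrite mulrBr mulr1 -expr2 -h subrr.
by move/eqP; rewrite mulf_eq0 subr_eq0 => /orP [] /eqP ->.
Qed.

Lemma star1 : star 1 = 1.
Proof. by rewrite -[RHS]starK -[star 1 in RHS]mulr1 starM starK mulr1. Qed.

Lemma is_proj_compl p : is_proj p -> is_proj (1 - p).
Proof.
move=> [sp pp]; split; first by rewrite starD starN sp star1.
by rewrite mulrBr mulr1 mulrBl mul1r pp subrr subr0.
Qed.

End CStarBasics.

(** * The unit is an extreme point of the unit ball *)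

Section Extreme.
Variables (R : realType) (B : cstarAlgType R).
Implicit Types e t x : B.
Local Notation N := (@cnorm R B).
Local Notation star := (@star R B).

(** Here e is meant to be the unit of a corner e B e, and t an element of it. *)
Definition straddles e t : Prop :=
  [/\ star t = t, e * t = t, t * e = t, N (e + t) <= 1 & N (e - t) <= 1].

(** Linear combinations of e, t, t^2, t^3, by their coefficients: identities
   between polynomials in t reduce to identities between complex numbers. *)
Definition cubic e t (a b c d : R[i]) : B :=
  a *: e + b *: t + c *: (t * t) + d *: (t * t * t).

Lemma cubicD e t (a b c d a' b' c' d' : R[i]) :
  cubic e t a b c d + cubic e t a' b' c' d' =
  cubic e t (a + a') (b + b') (c + c') (d + d').
Proof.
rewrite /cubic !scalerDl [LHS]addrACA; congr (_ + _).
rewrite [LHS]addrACA; congr (_ + _); exact: addrACA.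
Qed.

Lemma cubicZ e t (z a b c d : R[i]) :
  z *: cubic e t a b c d = cubic e t (z * a) (z * b) (z * c) (z * d).
Proof. by rewrite /cubic !scalerDr !scalerA. Qed.

Lemma cubicM e t (l a b c : R[i]) : e * e = e -> e * t = t -> t * e = t ->
  cubic e t 1 l 0 0 * cubic e t a b c 0 =
  cubic e t a (b + l * a) (c + l * b) (l * c).
Proof.
move=> ee et te.
have eM : e * cubic e t a b c 0 = cubic e t a b c 0.
  by rewrite /cubic !mulrDr -!scalerAr ee et !mulrA et.
have tM : t * cubic e t a b c 0 = cubic e t 0 a b c.
  by rewrite /cubic !mulrDr -!scalerAr te !scale0r addr0 add0r !mulrA.
rewrite {1}/cubic !scale0r !addr0 scale1r mulrDl eM -scalerAl tM cubicZ cubicD.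
by congr cubic; ring.
Qed.

Lemma cubic_lin e t (l : R[i]) : e + l *: t = cubic e t 1 l 0 0.
Proof. by rewrite /cubic !scale0r !addr0 scale1r. Qed.

Lemma straddles_powers e t (l : R[i]) :
  e * e = e -> e * t = t -> t * e = t ->
  (e + l *: t) ^+ 2 = cubic e t 1 (2 * l) (l ^+ 2) 0 /\
  (e + l *: t) ^+ 3 = cubic e t 1 (3 * l) (3 * l ^+ 2) (l ^+ 3).
Proof.
move=> ee et te.
have sq : (e + l *: t) ^+ 2 = cubic e t 1 (2 * l) (l ^+ 2) 0.
  by rewrite expr2 cubic_lin cubicM //; congr cubic; ring.
split=> //; rewrite exprS sq cubic_lin cubicM //.
by congr cubic; ring.
Qed.

Lemma cnormX_le1 x n : N x <= 1 -> N (x ^+ n.+1) <= 1.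
Proof.
move=> x1; elim: n => [|n IH]; first by rewrite expr1.
rewrite exprS; apply: le_trans (cnormM_le _ _) _.
by rewrite mulr_ile1 ?cnorm_ge0.
Qed.

Lemma straddles_opp e t : straddles e t -> straddles e (- t).
Proof.
by move=> [st et te h1 h2]; split; rewrite ?starN ?mulrN ?mulNr ?st ?et ?te ?opprK.
Qed.

Lemma straddles_le_half e t : e * e = e -> straddles e t -> N t <= 2^-1.
Proof.
move=> ee [st et te h1 h2].
have [a2 _] := straddles_powers 1 ee et te.
have [b2 _] := straddles_powers (-1) ee et te.
have : 4 *: t = (e + 1 *: t) ^+ 2 - (e + (-1) *: t) ^+ 2.
  rewrite a2 b2 -scaleN1r cubicZ cubicD -[LHS]add0r -(scale0r e).
  transitivity (cubic e t 0 4 0 0); last by congr cubic; ring.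
  by rewrite /cubic !scale0r !addr0.
rewrite scale1r scaleN1r => /(congr1 N); rewrite cnormZ normc_nat => h.
have := cnormB_le ((e + t) ^+ 2) ((e - t) ^+ 2).
have := @cnormX_le1 _ 1 h1; have := @cnormX_le1 _ 1 h2.
by rewrite -h; lra.
Qed.

(** Averaging (e + t)^2 and (e - t)^2 gives e + t^2, of norm at most 1; this is
   also the square of the modulus of e + it and of e - it. *)
Lemma straddles_imaginary e t (l : R[i]) : star e = e -> e * e = e ->
  l ^+ 2 = -1 -> l^* = - l ->
  straddles e t -> N (e + l *: t) <= 1.
Proof.
move=> se ee l2 lJ [st et te h1 h2].
have [a2 _] := straddles_powers 1 ee et te.
have [b2 _] := straddles_powers (-1) ee et te.
rewrite scale1r in a2; rewrite scaleN1r in b2.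
have sq : 2 *: (star (e + l *: t) * (e + l *: t)) = (e + t) ^+ 2 + (e - t) ^+ 2.
  rewrite a2 b2 cubicD.
  rewrite starD starZ st se lJ !cubic_lin cubicM // cubicZ; congr cubic; try ring.
  rewrite mulNr -expr2 l2; ring.
have := cnormD_le ((e + t) ^+ 2) ((e - t) ^+ 2).
have := @cnormX_le1 _ 1 h1; have := @cnormX_le1 _ 1 h2.
rewrite -sq cnormZ normc_nat cnorm_starM => p1 p2 p3.
by rewrite -(@expr_le1 _ 2) ?cnorm_ge0 //; lra.
Qed.

Definition amplify t : B := (3 / 2) *: t + 2^-1 *: (t * t * t).

(** In the average of (e + l t)^3 over l = 1, i, -i with weights 1/2, 1/4, 1/4
   the constant term is e, the quadratic term cancels, and the linear term is
   3/2 t: the perturbation of e has grown, and all averaged elements have norm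
   at most 1. *)
Lemma amplifyE e t (l : R[i]) :
  e * e = e -> e * t = t -> t * e = t -> l ^+ 2 = -1 ->
  4 *: (e + amplify t) =
  2 *: (e + t) ^+ 3 + (e + l *: t) ^+ 3 + (e + (- l) *: t) ^+ 3.
Proof.
move=> ee et te l2.
have -> : e + amplify t = cubic e t 1 (3 / 2) 0 2^-1.
  by rewrite /cubic /amplify scale1r scale0r addr0 addrA.
have [_] := straddles_powers 1 ee et te; rewrite scale1r => ->.
have [_ ->] := straddles_powers l ee et te.
have [_ ->] := straddles_powers (- l) ee et te.
rewrite !cubicZ !cubicD; congr cubic; try field; try ring.
by rewrite sqrrN l2; ring.
Qed.

Lemma amplifyN t : amplify (- t) = - amplify t.
Proof. by rewrite /amplify scalerN !mulNr !mulrN !mulNr opprK scalerN opprD. Qed.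

Lemma amplify_le1 e t : star e = e -> e * e = e ->
  straddles e t -> N (e + amplify t) <= 1.
Proof.
move=> se ee ht; have [st et te h1 h2] := ht.
have i2 : ('i : R[i]) ^+ 2 = -1 by exact: sqr_i.
have hi : N (e + 'i *: t) <= 1.
  by apply: straddles_imaginary => //; exact: conjCi.
have hmi : N (e + (- 'i) *: t) <= 1.
  apply: straddles_imaginary => //; first by rewrite sqrrN.
  by rewrite rmorphN; congr (- _); exact: conjCi.
have := cnormD_le (2 *: (e + t) ^+ 3 + (e + 'i *: t) ^+ 3)
  ((e + (- 'i) *: t) ^+ 3).
have := cnormD_le (2 *: (e + t) ^+ 3) ((e + 'i *: t) ^+ 3).
have := @cnormX_le1 _ 2 h1; have := @cnormX_le1 _ 2 hi.
have := @cnormX_le1 _ 2 hmi.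
by rewrite -(amplifyE ee et te i2) !cnormZ !normc_nat; lra.
Qed.

Lemma straddles_amplify e t : star e = e -> e * e = e ->
  straddles e t -> straddles e (amplify t).
Proof.
move=> se ee ht; have [st et te h1 h2] := ht.
have cj (n m : nat) : (n%:R / m%:R : R[i])^* = n%:R / m%:R.
  by rewrite fmorph_div !rmorph_nat.
split.
- have := cj 3 2; have := cj 1 2; rewrite mul1r => j1 j3.
  by rewrite starD !starZ !starM st j1 j3 !mulrA.
- by rewrite mulrDr -!scalerAr !mulrA et.
- by rewrite mulrDl -!scalerAl te -!mulrA te !mulrA.
- exact: amplify_le1.
by rewrite -amplifyN; apply: amplify_le1 => //; apply: straddles_opp.
Qed.

Lemma cnorm_amplify e t : e * e = e -> straddles e t ->
  5 * N t <= 4 * N (amplify t).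
Proof.
move=> ee ht; have tl := straddles_le_half ee ht; have t0 := cnorm_ge0 t.
have := cnormB_le (amplify t) (2^-1 *: (t * t * t)).
rewrite {1}/amplify addrK !cnormZ.
have nhalf : normc (2^-1 : R[i]) = 2^-1 by rewrite normcV normc_nat.
rewrite normcM nhalf normc_nat => h.
have := cnormM_le (t * t) t; have := cnormM_le t t => h2 h3.
have h4 : N (t * t * t) <= N t * N t * N t.
  by apply: le_trans h3 _; rewrite ler_wpM2r.
by nra.
Qed.

(** If t were not 0, iterating [amplify] would multiply its norm by at least 5/4
   each time, while [straddles_le_half] keeps all norms below 1/2. *)
Lemma straddles_eq0 e t : star e = e -> e * e = e -> straddles e t -> t = 0.
Proof.
move=> se ee ht; apply: cnorm_eq0.
(* From k + 4 to k + 5 the factor is at most 5/4; this replaces powers of 5/4. *)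
have bound k : (k + 4)%:R * N t <= 2.
  elim: k t ht => [|k IH] t ht.
    by have := straddles_le_half ee ht; lra.
  have := IH _ (straddles_amplify se ee ht).
  have := cnorm_amplify ee ht; have := cnorm_ge0 t.
  rewrite addSn -[(_.+1)%:R]natr1 natrD.
  have : 0 <= k%:R :> R by exact: ler0n.
  by nra.
apply/eqP; rewrite eq_le cnorm_ge0 andbT leNgt; apply/negP => t0.
have := archi_boundP (ltW (divr_gt0 (ltr0n R 2) t0)); set k := Num.bound _.
have := bound k; rewrite natrD.
have -> : 2 / N t = 2 * (N t)^-1 by [].
move=> h1 h2.
have : 2 < k%:R * N t by rewrite -ltr_pdivrMr.
by nra.
Qed.

End Extreme.

(** * Projections that sum to one are orthogonal *)

Section Projections.
Variables (R : realType) (B : cstarAlgType R) (I : finType).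
Local Notation N := (@cnorm R B).
Local Notation star := (@star R B).

(** Since - a_i is the sum of the other a_j, e *+ c + a_i is the sum of c elements
   of norm at most 1, and so is e *+ c - a_i. Hence a_i / c straddles e. *)
Lemma sum_corner_eq0 (e : B) (a : I -> B) (P : pred I) :
  is_proj e -> (forall i, star (a i) = a i) ->
  (forall i, e * a i = a i) -> (forall i, a i * e = a i) ->
  (forall i, N (e - a i) <= 1) ->
  \sum_(i | P i) a i = 0 -> forall i, P i -> a i = 0.
Proof.
move=> pe sa ea ae ha sum0 i Pi; have [se ee] := pe.
(* The extra 1 keeps c positive when i is the only index. *)
pose c := #|[pred j | P j && (j != i)]|.+1.
have c0 : (0 : R) < c%:R by rewrite ltr0n.
have c1 : (1 : R) <= c%:R by rewrite ler1n.
have ce : e *+ c + a i = \sum_(j | P j && (j != i)) (e - a j) + e.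
  rewrite sumrB sumr_const mulrSr addrAC; congr (_ + _); congr (_ + _).
  by move: sum0; rewrite (bigD1 i) //= => /eqP; rewrite addr_eq0 => /eqP.
have hp : N (e *+ c + a i) <= c%:R.
  rewrite ce; apply: le_trans (cnormD_le _ _) _.
  rewrite /c -natr1; apply: lerD; last exact: cnorm_proj.
  apply: le_trans (cnorm_sum _ _) _.
  rewrite -[leRHS]sumr_const; exact: ler_sum.
have hm : N (e *+ c - a i) <= c%:R.
  rewrite /c mulrSr -addrA; apply: le_trans (cnormD_le _ _) _.
  rewrite -natr1 cnormMn; apply: lerD; last exact: ha.
  by rewrite ler_piMr ?ler0n // cnorm_proj.
have scale (x : B) : N x <= c%:R -> N ((c%:R)^-1 *: x) <= 1.
  by move=> h; rewrite cnormZ normcV normc_nat ler_pdivrMl // mulr1.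
have ci : (c%:R : R[i])^-1 *: (e *+ c) = e.
  by rewrite -scalerMnr scalerMnl -mulr_natr mulVf ?scale1r ?pnatr_eq0.
have : (c%:R : R[i])^-1 *: a i = 0.
  apply: (straddles_eq0 se ee); split.
  - by rewrite starZ sa fmorphV rmorph_nat.
  - by rewrite -scalerAr ea.
  - by rewrite -scalerAl ae.
  - by rewrite -{1}ci -scalerDr scale.
  by rewrite -{1}ci -scalerBr scale.
by move/eqP; rewrite scaler_eq0 invr_eq0 pnatr_eq0 /= => /eqP.
Qed.

(** The elements p_j p_k p_j with k <> j have sum p_j (1 - p_j) p_j = 0, and they
   lie within distance 1 of p_j because p_j (1 - p_k) p_j is the square of the
   modulus of (1 - p_k) p_j. *)
Lemma proj_sum1_orthogonal (p : I -> B) :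
  (forall i, is_proj (p i)) -> \sum_i p i = 1 ->
  forall i j, i != j -> p i * p j = 0.
Proof.
move=> pp sum1 i j ij; have [sj jj] := pp j.
pose a k := p j * p k * p j.
have aE k : a k = star (p k * p j) * (p k * p j).
  by have [sk kk] := pp k; rewrite starM sk sj /a -!mulrA (mulrA (p k)) kk.
apply: cnorm_star_mul_eq0; rewrite -aE.
apply: (@sum_corner_eq0 (p j) a (fun k => k != j)) => //.
- by move=> k; rewrite aE starM starK.
- by move=> k; rewrite /a !mulrA jj.
- by move=> k; rewrite /a -!mulrA jj.
- move=> k; have [sq qq] := is_proj_compl (pp k).
  have -> : p j - a k = star ((1 - p k) * p j) * ((1 - p k) * p j).
    rewrite starM sq sj -!mulrA (mulrA (1 - p k)) qq.
    by rewrite mulrBl mul1r mulrBr jj /a mulrA.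
  rewrite cnorm_starM expr_le1 ?cnorm_ge0 //.
  apply: le_trans (cnormM_le _ _) _.
  by rewrite mulr_ile1 ?cnorm_ge0 ?cnorm_proj //; apply: is_proj_compl.
rewrite /a -mulr_suml -mulr_sumr.
have -> : \sum_(k | k != j) p k = 1 - p j.
  by rewrite -sum1 [in RHS](bigD1 j) //= [p j + _]addrC addrK.
by rewrite mulrBr mulr1 jj subrr mul0r.
Qed.

End Projections.

(** * The C*-algebra of functions on a finite group *)

Section FunctionAlgebra.
Variables (R : realType) (gT : finGroupType).

(** The group structure only serves to provide a point of the domain, without
   which the constants 0 and 1 would agree. *)
Definition group_fun : Type := {ffun gT -> R[i]}.
Implicit Types (a b : group_fun) (c d : R[i]).
HB.instance Definition _ := GRing.PzRing.copy group_fun {ffun gT -> R[i]}.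

Fact group_fun_oner_neq0 : (1 : group_fun) != 0.
Proof. by apply/eqP => /ffunP /(_ 1%g) /eqP; rewrite !ffunE oner_eq0. Qed.
HB.instance Definition _ :=
  GRing.PzSemiRing_isNonZero.Build group_fun group_fun_oner_neq0.

Definition group_fun_scale (c : R[i]) (a : group_fun) : group_fun :=
  [ffun h => c * a h].

Fact group_fun_scaleA c d a :
  group_fun_scale c (group_fun_scale d a) = group_fun_scale (c * d) a.
Proof. by apply/ffunP => h; rewrite !ffunE mulrA. Qed.
Fact group_fun_scale1 : left_id 1 group_fun_scale.
Proof. by move=> a; apply/ffunP => h; rewrite !ffunE mul1r. Qed.
Fact group_fun_scaleDr : right_distributive group_fun_scale +%R.
Proof. by move=> c a b; apply/ffunP => h; rewrite !ffunE mulrDr. Qed.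
Fact group_fun_scaleDl a : {morph group_fun_scale^~ a : c d / c + d}.
Proof. by move=> c d; apply/ffunP => h; rewrite !ffunE mulrDl. Qed.
HB.instance Definition _ := GRing.Zmodule_isLmodule.Build R[i] group_fun
  group_fun_scaleA group_fun_scale1 group_fun_scaleDr group_fun_scaleDl.

Fact group_fun_scaleAl (c : R[i]) (a b : group_fun) : c *: (a * b) = c *: a * b.
Proof. by apply/ffunP => h; rewrite !ffunE mulrA. Qed.
HB.instance Definition _ :=
  GRing.Lmodule_isLalgebra.Build R[i] group_fun group_fun_scaleAl.

Fact group_fun_scaleAr (c : R[i]) (a b : group_fun) : c *: (a * b) = a * (c *: b).
Proof. by apply/ffunP => h; rewrite !ffunE mulrCA. Qed.
HB.instance Definition _ :=
  GRing.Lalgebra_isAlgebra.Build R[i] group_fun group_fun_scaleAr.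

Definition group_fun_star (a : group_fun) : group_fun := [ffun h => (a h)^*].
Definition group_fun_norm (a : group_fun) : R :=
  \big[Num.max/0]_h normc (a h).

Lemma normc_le_group_fun_norm a h : normc (a h) <= group_fun_norm a.
Proof. exact: (le_bigmax _ (fun h => normc (a h))). Qed.

Lemma group_fun_norm_ge0 a : 0 <= group_fun_norm a.
Proof. exact: bigmax_ge_id. Qed.

Lemma group_fun_norm_le a x : 0 <= x -> (forall h, normc (a h) <= x) ->
  group_fun_norm a <= x.
Proof. by move=> x0 ax; apply: bigmax_le. Qed.

Lemma group_fun_norm_lt a x : 0 < x -> (forall h, normc (a h) < x) ->
  group_fun_norm a < x.
Proof. by move=> x0 ax; apply: bigmax_lt. Qed.

Lemma normc_conj (c : R[i]) : normc c^* = normc c.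
Proof. by case: c => x y; rewrite /normc /= sqrrN. Qed.

Lemma normcD_le (c d : R[i]) : normc (c + d) <= normc c + normc d.
Proof. exact: le_normcD. Qed.

Lemma group_fun_starK : involutive group_fun_star.
Proof. by move=> a; apply/ffunP => h; rewrite !ffunE conjCK. Qed.
Lemma group_fun_starD : {morph group_fun_star : a b / a + b}.
Proof. by move=> a b; apply/ffunP => h; rewrite !ffunE rmorphD. Qed.
Lemma group_fun_starZ (c : R[i]) (a : group_fun) :
  group_fun_star (c *: a) = c^* *: group_fun_star a.
Proof. by apply/ffunP => h; rewrite !ffunE rmorphM. Qed.
Lemma group_fun_starM a b :
  group_fun_star (a * b) = group_fun_star b * group_fun_star a.
Proof. by apply/ffunP => h; rewrite !ffunE rmorphM mulrC. Qed.

Lemma group_fun_normD_le a b :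
  group_fun_norm (a + b) <= group_fun_norm a + group_fun_norm b.
Proof.
apply: group_fun_norm_le => [|h]; first by rewrite addr_ge0 ?group_fun_norm_ge0.
rewrite ffunE; apply: le_trans (normcD_le _ _) _.
by apply: lerD; apply: normc_le_group_fun_norm.
Qed.

Lemma group_fun_normZ (c : R[i]) (a : group_fun) :
  group_fun_norm (c *: a) = normc c * group_fun_norm a.
Proof.
rewrite /group_fun_norm; elim/big_ind2: _ => [|x1 x2 y1 y2 -> ->|h _].
- by rewrite mulr0.
- by rewrite maxr_pMr ?normc_ge0.
by rewrite ffunE normcM.
Qed.

Lemma group_fun_norm_eq0 a : group_fun_norm a = 0 -> a = 0.
Proof.
move=> a0; apply/ffunP => h; rewrite ffunE; apply: eq0_normc; apply/eqP.
by rewrite eq_le normc_ge0 andbT -a0 normc_le_group_fun_norm.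
Qed.

Lemma group_fun_normM_le a b :
  group_fun_norm (a * b) <= group_fun_norm a * group_fun_norm b.
Proof.
apply: group_fun_norm_le => [|h]; first by rewrite mulr_ge0 ?group_fun_norm_ge0.
by rewrite ffunE normcM ler_pM ?normc_ge0 ?normc_le_group_fun_norm.
Qed.

Lemma group_fun_norm_starM a :
  group_fun_norm (group_fun_star a * a) = group_fun_norm a ^+ 2.
Proof.
apply/eqP; rewrite eq_le; apply/andP; split.
  apply: group_fun_norm_le => [|h]; first by rewrite exprn_ge0 ?group_fun_norm_ge0.
  rewrite !ffunE normcM normc_conj -expr2.
  by rewrite lerXn2r ?nnegrE ?normc_ge0 ?group_fun_norm_ge0 ?normc_le_group_fun_norm.
set x := group_fun_norm (_ * _); have x0 : 0 <= x by apply: group_fun_norm_ge0.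
rewrite -[x]sqr_sqrtr // lerXn2r ?nnegrE ?sqrtr_ge0 ?group_fun_norm_ge0 //.
apply: group_fun_norm_le => [|h]; first exact: sqrtr_ge0.
rewrite -[normc _]ger0_norm ?normc_ge0 // -sqrtr_sqr ler_wsqrtr //.
have := normc_le_group_fun_norm (group_fun_star a * a) h.
by rewrite !ffunE normcM normc_conj -expr2.
Qed.

Lemma real_cauchy_converges (x : nat -> R) :
  (forall e : R, 0 < e -> exists N : nat, forall p q : nat,
     (N <= p)%N -> (N <= q)%N -> `|x p - x q| < e) ->
  exists l : R, forall e : R, 0 < e -> exists N : nat, forall p : nat,
     (N <= p)%N -> `|x p - l| < e.
Proof.
move=> cx.
have : cvg (x @ \oo)%classic.
  apply/cauchy_cvgP/cauchy_exP => e /cx [N hN].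
  by exists (x N); exists N => // p Np; apply: hN.
move=> /cvgrPdist_lt h; exists (lim (x @ \oo)%classic) => e /h [N _ hN].
by exists N => p Np; rewrite distrC; apply: hN.
Qed.

Lemma normc_leD (c : R[i]) : normc c <= `|complex.Re c| + `|complex.Im c|.
Proof.
case: c => x y /=; have s0 : 0 <= `|x| + `|y| by rewrite addr_ge0.
rewrite -[leRHS]ger0_norm // -sqrtr_sqr ler_wsqrtr //.
by rewrite sqrrD !real_normK ?num_real // addrAC lerDl mulrn_wge0 ?mulr_ge0.
Qed.

Lemma Re_le_normc c : `|complex.Re c| <= normc c.
Proof. by case: c => x y /=; rewrite -sqrtr_sqr ler_wsqrtr // lerDl sqr_ge0. Qed.

Lemma Im_le_normc c : `|complex.Im c| <= normc c.
Proof. by case: c => x y /=; rewrite -sqrtr_sqr ler_wsqrtr // lerDr sqr_ge0. Qed.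

Lemma complex_cauchy_converges (x : nat -> R[i]) :
  (forall e : R, 0 < e -> exists N : nat, forall p q : nat,
     (N <= p)%N -> (N <= q)%N -> normc (x p - x q) < e) ->
  exists l : R[i], forall e : R, 0 < e -> exists N : nat, forall p : nat,
     (N <= p)%N -> normc (x p - l) < e.
Proof.
move=> cx.
have [|a ha] := @real_cauchy_converges (fun n => complex.Re (x n)).
  move=> e /cx [N hN]; exists N => p q /hN h /h; apply: le_lt_trans.
  by rewrite -raddfB Re_le_normc.
have [|b hb] := @real_cauchy_converges (fun n => complex.Im (x n)).
  move=> e /cx [N hN]; exists N => p q /hN h /h; apply: le_lt_trans.
  by rewrite -raddfB Im_le_normc.
exists (Complex a b) => e e0.
have e20 : 0 < e / 2 by rewrite divr_gt0.
have [N1 h1] := ha _ e20; have [N2 h2] := hb _ e20.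
exists (maxn N1 N2) => p; rewrite geq_max => /andP [/h1 p1 /h2 p2].
apply: le_lt_trans (normc_leD _) _; rewrite !raddfB /=; lra.
Qed.

Lemma group_fun_norm_complete (x : nat -> group_fun) :
  (forall e : R, 0 < e -> exists N : nat, forall p q : nat,
     (N <= p)%N -> (N <= q)%N -> group_fun_norm (x p - x q) < e) ->
  exists l : group_fun, forall e : R, 0 < e -> exists N : nat,
    forall p : nat, (N <= p)%N -> group_fun_norm (x p - l) < e.
Proof.
move=> cx.
have lim h : exists l : R[i], forall e : R, 0 < e -> exists N : nat,
    forall p : nat, (N <= p)%N -> normc (x p h - l) < e.
  apply: complex_cauchy_converges => e /cx [N hN].
  exists N => p q /hN H /H; apply: le_lt_trans.
  by have := normc_le_group_fun_norm (x p - x q) h; rewrite !ffunE.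
have [l hl] := fin_all_exists lim.
exists [ffun h => l h] => e e0.
have [N hN] := fin_all_exists (fun h => hl h _ e0).
exists (\max_h N h)%N => p hp.
apply: group_fun_norm_lt => // h; rewrite !ffunE; apply: hN.
by apply: leq_trans hp; apply: leq_bigmax.
Qed.

HB.instance Definition _ := isCStar.Build R group_fun
  group_fun_starK group_fun_starD group_fun_starZ group_fun_starM
  group_fun_normD_le group_fun_normZ group_fun_norm_eq0 group_fun_normM_le
  group_fun_norm_starM group_fun_norm_complete.

Lemma group_fun_mulC (a b : group_fun) : a * b = b * a.
Proof. by apply/ffunP => h; rewrite !ffunE mulrC. Qed.

End FunctionAlgebra.

(** * Magic unitaries of a graph *)

Section MagicUnitary.
Variables (R : realType) (G : sgraph) (B : cstarAlgType R).
Implicit Types (v : G -> G -> B) (x y k l : G).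

Lemma qut_proj v x y : qut_relations v -> is_proj (v x y).
Proof. by case=> /(_ x y) [s h] _ _; split; [rewrite -s | rewrite -expr2 -h]. Qed.

(** The relations are symmetric under exchanging rows and columns, because
   both the edge condition and the two sum conditions are. *)
Lemma qut_transpose v : qut_relations v -> qut_relations (fun x y => v y x).
Proof.
case=> pv sv ev; split=> [i j|i|i j k l e]; first exact: pv.
  by have [h1 h2] := sv i.
by apply: ev; rewrite eq_sym.
Qed.

Lemma qut_row_orthogonal v x y z : qut_relations v -> y != z ->
  v x y * v x z = 0.
Proof.
move=> rv; apply: (@proj_sum1_orthogonal _ _ _ (v x)) => [i|].
  exact: qut_proj.
by case: rv => _ /(_ x) [].
Qed.

Lemma qut_mul_nonedge v x y k l : qut_relations v ->
  edge x k -> ~~ edge y l -> v x y * v k l = 0.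
Proof. by case=> _ _ ev xk /negbTE yl; apply: ev; rewrite xk yl. Qed.

(** The row of k sums to 1, and the terms outside the neighbours of y are
   killed by v x y. *)
Lemma qut_sum_neighbours v x y k : qut_relations v -> edge x k ->
  \sum_(l | edge y l) v x y * v k l = v x y.
Proof.
move=> rv xk; have [_ /(_ k) [sk _] _] := rv.
rewrite -[RHS]mulr1 -sk mulr_sumr [RHS](bigID (edge y)) /= [X in _ + X]big1.
  by rewrite addr0.
by move=> l yl; apply: qut_mul_nonedge.
Qed.

(** Double counting of the edges at x and at y: summing v x y * v k l over all
   pairs of neighbours gives deg x copies of v x y along the rows, and deg y
   copies along the columns. *)
Lemma qut_degree v x y : qut_relations v -> #|edge x| != #|edge y| ->
  v x y = 0.
Proof.
move=> rv dxy.
have : v x y *+ #|edge x| = v x y *+ #|edge y|.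
  rewrite -!sumr_const.
  transitivity (\sum_(k in edge x) \sum_(l in edge y) v x y * v k l).
    by apply: eq_bigr => k xk; rewrite (qut_sum_neighbours y rv).
  rewrite exchange_big /=; apply: eq_bigr => l yl.
  exact: (qut_sum_neighbours x (qut_transpose rv)).
move/(congr1 (@cnorm R B)); rewrite !cnormMn => /eqP.
rewrite -subr_eq0 -mulrBl mulf_eq0 subr_eq0 eqr_nat (negbTE dxy) /=.
by move/eqP/cnorm_eq0.
Qed.

(** By [qut_sum_neighbours], v x y is the sum of the v x y * v k l over the
   neighbours l of y. *)
Lemma qut_refine v x y k : qut_relations v -> edge x k ->
  (forall l, edge y l -> v k l = 0) -> v x y = 0.
Proof.
move=> rv xk h; rewrite -(qut_sum_neighbours y rv xk) big1 // => l yl.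
by rewrite h ?mulr0.
Qed.

End MagicUnitary.

(** * Graphs whose quantum automorphisms come from a free action *)

Section FreeAction.
Variables (R : realType) (gT : finGroupType) (G : sgraph).
Variable act : gT -> G -> G.
Implicit Types (x y : G) (h : gT).

Definition free_at x := injective (act^~ x).
Definition edge_preserving :=
  forall h x y, edge (act h x) (act h y) = edge x y.

(** The row of y shows that v x (act h x) lies below v y (act h y), all other
   candidates for y being excluded. Freeness makes the latter projections
   pairwise orthogonal while the former already sum to 1, so they agree. *)
Lemma qut_propagate (B : cstarAlgType R) (v : G -> G -> B) x y :
  qut_relations v -> edge_preserving -> free_at y -> edge x y ->
  \sum_h v x (act h x) = 1 ->
  (forall h z, edge (act h x) z -> z != act h y -> v y z = 0) ->
  forall h, v y (act h y) = v x (act h x).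
Proof.
move=> rv epres fy exy sum1 kill h.
have wv k : v x (act k x) * v y (act k y) = v x (act k x).
  rewrite -[RHS](qut_sum_neighbours (act k x) rv exy).
  rewrite (bigD1 (act k y)) ?epres //= big1 ?addr0 // => z /andP [xz zy].
  by rewrite (kill k) ?mulr0.
have vw k : v y (act k y) * v x (act k x) = v x (act k x).
  have [sx _] := qut_proj x (act k x) rv; have [sy _] := qut_proj y (act k y) rv.
  by rewrite -[LHS]starK starM sx sy wv sx.
rewrite -[LHS]mulr1 -sum1 mulr_sumr (bigD1 h) //= vw big1 ?addr0 // => k kh.
rewrite -(vw k) mulrA qut_row_orthogonal ?mul0r //.
by apply: contraNneq kh => /fy ->.
Qed.

Definition orbit_indicator x y : group_fun R gT :=
  [ffun h => (act h x == y)%:R].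

Lemma orbit_indicator_relations :
  (forall h, injective (act h)) -> edge_preserving ->
  qut_relations orbit_indicator.
Proof.
move=> inj epres; split=> [i j|i|i j k l e].
- split; apply/ffunP => h.
    by rewrite !ffunE rmorph_nat.
  by rewrite expr2 !ffunE -natrM mulnb andbb.
- split; apply/ffunP => h; rewrite sum_ffunE !ffunE.
    rewrite (bigD1 (act h i)) //= big1 => [|l li]; first by rewrite addr0 ffunE eqxx.
    by rewrite ffunE eq_sym (negbTE li).
  transitivity (\sum_l (l == i)%:R : R[i]).
    by rewrite [RHS](reindex_inj (inj h)); apply: eq_bigr => l _; rewrite ffunE.
  by rewrite (bigD1 i) //= big1 => [|l /negbTE -> //]; rewrite eqxx addr0.
apply/ffunP => h; rewrite !ffunE -natrM mulnb.
case: eqP => [ji|//]; case: eqP => [kl|//].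
by rewrite -ji -kl epres eqxx in e.
Qed.

Section Universal.
Variables (B : cstarAlgType R) (v : G -> G -> B) (x0 : G).
Hypotheses (rv : qut_relations v) (free : forall x, free_at x).
Hypothesis sum1 : \sum_h v x0 (act h x0) = 1.
Hypothesis indep : forall x h, v x (act h x) = v x0 (act h x0).

(** Integration of a against the projection-valued measure with mass
   v x0 (act h x0) at h. *)
Definition integrate (a : group_fun R gT) : B := \sum_h a h *: v x0 (act h x0).

Lemma integrate_linear : linear integrate.
Proof.
move=> c a b; rewrite /integrate scaler_sumr -big_split /=.
by apply: eq_bigr => h _; rewrite !ffunE scalerDl scalerA.
Qed.

(** Freeness at x0 makes the masses at distinct points orthogonal, which turns
   integration into a multiplicative map. *)
Lemma integrate_monoid : monoid_morphism integrate.
Proof.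
split; first by rewrite -sum1; apply: eq_bigr => h _; rewrite ffunE scale1r.
move=> a b; rewrite /integrate mulr_suml; apply: eq_bigr => h _.
rewrite mulr_sumr (bigD1 h) //= big1 ?addr0 => [|k kh].
  have [_ idem] := qut_proj x0 (act h x0) rv.
  by rewrite ffunE -scalerAl -scalerAr idem scalerA.
rewrite -scalerAl -scalerAr qut_row_orthogonal ?scaler0 //.
by apply: contraNneq kh => /free ->.
Qed.

Lemma integrate_star : star_morph integrate.
Proof.
move=> a; rewrite /integrate star_sum; apply: eq_bigr => h _.
by have [s _] := qut_proj x0 (act h x0) rv; rewrite starZ s ffunE.
Qed.

Lemma integrate_orbit_indicator x y : integrate (orbit_indicator x y) = v x y.
Proof.
rewrite -[RHS]mulr1 -sum1 mulr_sumr; apply: eq_bigr => h _.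
rewrite -(indep x) ffunE; case: (eqVneq (act h x) y) => [->|ne].
  by have [_ ->] := qut_proj x y rv; rewrite scale1r.
by rewrite scale0r qut_row_orthogonal // eq_sym.
Qed.

Lemma group_fun_sum_indicator (a : group_fun R gT) :
  a = \sum_h a h *: orbit_indicator x0 (act h x0).
Proof.
apply/ffunP => k; rewrite sum_ffunE (bigD1 k) //= big1 ?addr0 => [|h hk].
  by rewrite !ffunE eqxx mulr1.
rewrite !ffunE; case: eqP => [/free kh|_]; last by rewrite mulr0.
by rewrite kh eqxx in hk.
Qed.

Lemma integrate_universal :
  exists2 f : {lrmorphism group_fun R gT -> B}, qut_hom orbit_indicator v f
    & forall f' : {lrmorphism group_fun R gT -> B},
        qut_hom orbit_indicator v f' -> f' =1 f.
Proof.
pose fl := GRing.isLinear.Build R[i] (group_fun R gT) B *:%R integrate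
  integrate_linear.
pose fm := GRing.isMonoidMorphism.Build (group_fun R gT) B integrate
  integrate_monoid.
pose F : {lrmorphism group_fun R gT -> B} := HB.pack integrate fl fm.
exists F; first by split; [exact: integrate_star|exact: integrate_orbit_indicator].
move=> f' [_ f'u] a; rewrite [in LHS](group_fun_sum_indicator a) linear_sum /=.
by apply: eq_bigr => h _; rewrite linearZ /= f'u.
Qed.

End Universal.

(** Under the last hypothesis, a magic unitary on G amounts to a family of
   orthogonal projections indexed by the group, with sum 1, that is, to a
   *-homomorphism from the function algebra; so the latter is C(Qut(G)). *)
Lemma no_quantum_symmetry_of_free_action (x0 : G) :
  (forall h, injective (act h)) -> edge_preserving ->
  (forall x, free_at x) ->
  (forall (B : cstarAlgType R) (v : G -> G -> B), qut_relations v ->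
     \sum_h v x0 (act h x0) = 1 /\
     forall x h, v x (act h x) = v x0 (act h x0)) ->
  no_quantum_symmetry R G.
Proof.
move=> inj epres free H; exists (group_fun R gT), orbit_indicator.
split; last exact: group_fun_mulC.
split; first exact: orbit_indicator_relations.
by move=> B v rv; have [s i] := H B v rv; apply: integrate_universal s i.
Qed.

End FreeAction.

(** * Frucht graphs: the right translation action *)

Section Frucht.
Variables (gT : finGroupType) (n : nat) (g : 'I_n -> gT) (ginv : gT -> 'I_n).
Variable m : 'I_n -> 'I_n -> nat.
Hypotheses (gK : cancel g ginv) (ginvK : cancel ginv g).
Hypothesis adm : frucht_admissible g m.

Local Notation vertex := (frucht_vertex m).
Local Notation fedge := (@frucht_edge n m).
Implicit Types (i j : 'I_n) (e : offdiag n) (h : gT) (x y z : vertex).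

(** Right translation preserves the quotients g_i g_j^-1, hence m. *)
Definition shift h i := ginv (g i * h)%g.

Lemma g_shift h i : g (shift h i) = (g i * h)%g.
Proof. exact: ginvK. Qed.

Lemma g_inj : injective g.
Proof. exact: can_inj gK. Qed.

Lemma shift_inj h : injective (shift h).
Proof. by move=> i j /(congr1 g); rewrite !g_shift => /mulIg /g_inj. Qed.

Lemma shift_free i : injective (shift^~ i).
Proof. by move=> h k /= /(congr1 g); rewrite !g_shift => /mulgI. Qed.

Lemma sum_shift (V : zmodType) (F : 'I_n -> V) i :
  \sum_h F (shift h i) = \sum_j F j.
Proof.
rewrite (reindex (fun h => shift h i)) //.
exists (fun j => (g i)^-1 * g j)%g => [h|j] _ /=; first by rewrite g_shift mulKg.
by rewrite /shift mulKVg gK.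
Qed.

Lemma offdiag_shift h e : shift h (src e) != shift h (tgt e).
Proof. by rewrite (inj_eq (@shift_inj h)); exact: (valP e). Qed.

Definition shift_arc h e : offdiag n :=
  Sub (shift h (src e), shift h (tgt e)) (offdiag_shift h e).

Lemma offdiag_eq e e' : src e = src e' -> tgt e = tgt e' -> e = e'.
Proof.
move=> s t; apply: val_inj; move: s t; rewrite /src /tgt.
by case: (val e) (val e') => a b [c d] /= -> ->.
Qed.

Lemma shift_arc_inj h : injective (shift_arc h).
Proof.
move=> e e' /(congr1 val) [s t].
by apply: offdiag_eq; apply: (@shift_inj h).
Qed.

Lemma mval_ge2 e : (2 <= mval m e)%N.
Proof. exact: adm.1 (valP e). Qed.

Lemma mval_shift h e : mval m e = mval m (shift_arc h e).
Proof.
rewrite /mval; apply/(adm.2 _ _ _ _ (valP e) (offdiag_shift h e)).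
by rewrite !g_shift invMg mulgA mulgK.
Qed.

Lemma mval_eqP e e' : mval m e = mval m e' <->
  (g (src e) * (g (tgt e))^-1 = g (src e') * (g (tgt e'))^-1)%g.
Proof. exact: adm.2 (valP e) (valP e'). Qed.

Lemma mval_src_inj e e' : mval m e = mval m e' -> src e = src e' -> e = e'.
Proof.
move=> /mval_eqP mm s; apply: offdiag_eq => //.
by move: mm; rewrite s => /mulgI /invg_inj /g_inj.
Qed.

Lemma mval_tgt_inj e e' : mval m e = mval m e' -> tgt e = tgt e' -> e = e'.
Proof.
move=> /mval_eqP mm t; apply: offdiag_eq => //.
by move: mm; rewrite t => /mulIg /g_inj.
Qed.

Lemma q_bound h e : (2 * mval m e - 2 = 2 * mval m (shift_arc h e) - 2)%N.
Proof. by rewrite -mval_shift. Qed.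

Lemma r_bound h e : (2 * mval m e - 1 = 2 * mval m (shift_arc h e) - 1)%N.
Proof. by rewrite -mval_shift. Qed.

Definition act h x : vertex :=
  match x with
  | Fp i => Fp (shift h i)
  | Fq e k => Fq (shift_arc h e) (cast_ord (q_bound h e) k)
  | Fr e l => Fr (shift_arc h e) (cast_ord (r_bound h e) l)
  end.

(** The position on an attached path as a plain number, which frees equality of
   vertices from the dependent types of the positions. *)
Definition coord x : 'I_n + bool * offdiag n * nat :=
  match x with
  | Fp i => inl i
  | Fq e k => inr (false, e, k : nat)
  | Fr e l => inr (true, e, l : nat)
  end.

Lemma coord_inj : injective coord.
Proof.
case=> [i|e k|e k] [j|e' k'|e' k'] //= [].
- by move=> ->.
- by move=> ee; subst e' => /ord_inj ->.
- by move=> ee; subst e' => /ord_inj ->.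
Qed.

Lemma Fq_eq e (k k' : 'I_(2 * mval m e - 2)) : k = k' :> nat -> Fq e k = Fq e k'.
Proof. by move/ord_inj ->. Qed.

Lemma Fr_eq e (k k' : 'I_(2 * mval m e - 1)) : k = k' :> nat -> Fr e k = Fr e k'.
Proof. by move/ord_inj ->. Qed.

Lemma act_inj h : injective (act h).
Proof.
move=> x y /(congr1 coord) xy; apply: coord_inj.
move: xy; case: x => [i|e k|e k]; case: y => [j|e' k'|e' k'] //=.
- by case=> /shift_inj ->.
- by case=> s t ->; rewrite (@shift_arc_inj h e e') //; exact: offdiag_eq.
- by case=> s t ->; rewrite (@shift_arc_inj h e e') //; exact: offdiag_eq.
Qed.

Lemma act_edge h x y : fedge (act h x) (act h y) = fedge x y.
Proof.
rewrite /frucht_edge /=.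
by case: x => [i|e k|e k]; case: y => [j|e' k'|e' k'] //=;
  rewrite ?(inj_eq (@shift_inj h)) ?(inj_eq (@shift_arc_inj h)).
Qed.

Lemma act_free x : injective (act^~ x).
Proof.
move=> h k /= /(congr1 coord); case: x => [i|e a|e a] /= [].
- exact: shift_free.
- by move=> s _; apply: (@shift_free (src e)).
- by move=> s _; apply: (@shift_free (src e)).
Qed.

(** * Frucht graphs: colours of the vertices *)

Lemma p_neighbour i y : fedge (Fp i) y ->
  (exists e k, [/\ y = Fq e k, src e = i & k = 0 :> nat]) \/
  (exists e l, [/\ y = Fr e l, tgt e = i & l = 0 :> nat]).
Proof.
case: y => [j|e k|e k]; rewrite /frucht_edge //= orbF => /andP [/eqP -> /eqP k0].
- by left; exists e, k.
- by right; exists e, k.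
Qed.

Lemma q_neighbour e (k : 'I_(2 * mval m e - 2)) y : fedge (Fq e k) y ->
  [\/ y = Fp (src e) /\ k = 0 :> nat,
      exists l, [/\ y = Fr e l, k = 0 :> nat & l = 0 :> nat]
    | exists k', y = Fq e k' /\ (k' = k.+1 :> nat \/ k = k'.+1 :> nat)].
Proof.
rewrite /frucht_edge; case: y => [j|e' k'|e' k'] //=.
- by move=> /andP [/eqP -> /eqP ->]; constructor 1.
- move=> /orP [] /andP [/eqP ee /eqP kk]; constructor 3; subst e'; exists k'; auto.
- rewrite orbF => /and3P [/eqP ee /eqP kk /eqP ll].
  by constructor 2; subst e'; exists k'.
Qed.

Lemma r_neighbour e (l : 'I_(2 * mval m e - 1)) y : fedge (Fr e l) y ->
  [\/ y = Fp (tgt e) /\ l = 0 :> nat,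
      exists k, [/\ y = Fq e k, l = 0 :> nat & k = 0 :> nat]
    | exists l', y = Fr e l' /\ (l' = l.+1 :> nat \/ l = l'.+1 :> nat)].
Proof.
rewrite /frucht_edge; case: y => [j|e' k'|e' k'] //=.
- by move=> /andP [/eqP -> /eqP ->]; constructor 1.
- move=> /and3P [/eqP ee /eqP kk /eqP ll].
  by constructor 2; subst e'; exists k'.
- move=> /orP [] /andP [/eqP ee /eqP kk]; constructor 3; subst e'; exists k'; auto.
Qed.

(** The number of vertices beyond x on its attached path. The value 0 at the p_i
   is a default. *)
Definition tail x : nat :=
  match x with
  | Fp _ => 0%N
  | Fq e k => (2 * mval m e - 3 - k)%N
  | Fr e l => (2 * mval m e - 2 - l)%N
  end.

(** For n >= 3 this is the minimum of 4 and the degree of x: degrees at the p_i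
   are 2n - 2 >= 4, and at most 3 elsewhere. *)
Definition capped_degree x : nat :=
  match x with
  | Fp _ => 4%N
  | Fq _ k => if k == 0%N :> nat then 3%N else if tail x == 0%N then 1%N else 2%N
  | Fr _ l => if l == 0%N :> nat then 3%N else if tail x == 0%N then 1%N else 2%N
  end.

Definition is_p x : bool := if x is Fp _ then true else false.

Lemma card_edge_le x (s : seq ('I_n + bool * offdiag n * nat)) :
  (forall y, fedge x y -> coord y \in s) -> (#|fedge x| <= size s)%N.
Proof.
move=> h; rewrite cardE -(size_map coord); apply: uniq_leq_size.
  by rewrite (map_inj_uniq coord_inj) enum_uniq.
by move=> c /mapP [y]; rewrite mem_enum => /h ys ->.
Qed.

(** Any key that separates the listed vertices will do, which spares the
   comparison of positions with dependent types. *)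
Lemma card_edge_ge (T : eqType) (key : vertex -> T) x (s : seq vertex) :
  uniq (map key s) -> all (fedge x) s -> (size s <= #|fedge x|)%N.
Proof.
move=> us /allP h; rewrite cardE; apply: uniq_leq_size; first exact: map_uniq us.
by move=> y /h; rewrite mem_enum.
Qed.

Lemma card_edge_nonp x : ~~ is_p x -> (#|fedge x| <= capped_degree x)%N.
Proof.
case: x => [//|e k|e l] _ /=.
- case: ifP => [/eqP k0|/eqP k0].
    apply: (@card_edge_le _ [:: inl (src e); inr (true, e, 0%N); inr (false, e, 1%N)]).
    move=> y /q_neighbour [[-> _]|[l [-> _ l0]]|[k' [-> [kk|kk]]]] /=.
    + by rewrite !inE eqxx.
    + by rewrite l0 !inE eqxx orbT.
    + by rewrite kk k0 !inE eqxx !orbT.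
    + by rewrite k0 in kk.
  case: ifP => [/eqP t0|t0].
    apply: (@card_edge_le _ [:: inr (false, e, k.-1)]).
    move=> y /q_neighbour [[_ k00]|[l [_ k00 _]]|[k' [-> [kk|kk]]]] //=.
      by have := ltn_ord k'; rewrite kk; lia.
    by rewrite kk inE eqxx.
  apply: (@card_edge_le _ [:: inr (false, e, k.-1); inr (false, e, k.+1)]).
  move=> y /q_neighbour [[_ k00]|[l [_ k00 _]]|[k' [-> [kk|kk]]]] //=.
    by rewrite kk !inE eqxx orbT.
  by rewrite kk inE eqxx.
- case: ifP => [/eqP k0|/eqP k0].
    apply: (@card_edge_le _ [:: inl (tgt e); inr (false, e, 0%N); inr (true, e, 1%N)]).
    move=> y /r_neighbour [[-> _]|[k [-> _ l0]]|[k' [-> [kk|kk]]]] /=.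
    + by rewrite !inE eqxx.
    + by rewrite l0 !inE eqxx orbT.
    + by rewrite kk k0 !inE eqxx !orbT.
    + by rewrite k0 in kk.
  case: ifP => [/eqP t0|t0].
    apply: (@card_edge_le _ [:: inr (true, e, l.-1)]).
    move=> y /r_neighbour [[_ k00]|[k [_ k00 _]]|[k' [-> [kk|kk]]]] //=.
      by have := ltn_ord k'; rewrite kk; lia.
    by rewrite kk inE eqxx.
  apply: (@card_edge_le _ [:: inr (true, e, l.-1); inr (true, e, l.+1)]).
  move=> y /r_neighbour [[_ k00]|[k [_ k00 _]]|[k' [-> [kk|kk]]]] //=.
    by rewrite kk !inE eqxx orbT.
  by rewrite kk inE eqxx.
Qed.

Lemma exists_notin (s : seq 'I_n) : (size s < n)%N -> exists i, i \notin s.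
Proof.
move=> sn; apply/existsP; rewrite -negb_forall; apply: contraL sn => /forallP all_s.
by rewrite -leqNgt -[n in (n <= _)%N]card_ord cardE; apply: uniq_leq_size (enum_uniq _) _.
Qed.

Lemma card_edge_ge_p i : (2 < n)%N -> (4 <= #|fedge (Fp i)|)%N.
Proof.
move=> n3.
- have [j] := @exists_notin [:: i] (ltnW n3); rewrite inE => ji.
  have [k] := @exists_notin [:: i; j] n3; rewrite !inE negb_or => /andP [ki kj].
  have q0 e : (0 < 2 * mval m e - 2)%N by have := mval_ge2 e; lia.
  have r0 e : (0 < 2 * mval m e - 1)%N by have := mval_ge2 e; lia.
  have ij : i != j by rewrite eq_sym.
  have ik : i != k by rewrite eq_sym.
  pose out a (ia : i != a) : offdiag n := exist _ (i, a) ia.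
  pose inc a (ai : a != i) : offdiag n := exist _ (a, i) ai.
  pose other y := match y with
    Fp a => (false, a) | Fq e _ => (false, tgt e) | Fr e _ => (true, src e) end.
  apply: (@card_edge_ge _ other _ [:: Fq (out j ij) (Ordinal (q0 _));
    Fq (out k ik) (Ordinal (q0 _)); Fr (inc j ji) (Ordinal (r0 _));
    Fr (inc k ki) (Ordinal (r0 _))]).
    have jk : (j == k) = false by rewrite eq_sym (negbTE kj).
    rewrite /other /= -[tgt (out j ij)]/j -[tgt (out k ik)]/k.
    rewrite -[src (inc j ji)]/j -[src (inc k ki)]/k.
    by rewrite !inE !xpair_eqE jk.
  by rewrite /frucht_edge /= !eqxx.
Qed.

Lemma card_edge_ge_q e (k : 'I_(2 * mval m e - 2)) :
  (capped_degree (Fq e k) <= #|fedge (Fq e k)|)%N.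
Proof.
rewrite /=.
- have := mval_ge2 e; have := ltn_ord k => kb m2.
  case: ifP => [/eqP k0|/eqP k0].
    have q1 : (1 < 2 * mval m e - 2)%N by lia.
    have r0 : (0 < 2 * mval m e - 1)%N by lia.
    apply: (@card_edge_ge _ coord _ [:: Fp (src e); Fr e (Ordinal r0); Fq e (Ordinal q1)]).
      by [].
    by rewrite /= /frucht_edge /= k0 !eqxx.
  have kp : (k.-1 < 2 * mval m e - 2)%N by lia.
  case: ifP => [/eqP t0|/eqP t0].
    apply: (@card_edge_ge _ coord _ [:: Fq e (Ordinal kp)]) => //=.
    by rewrite andbT /frucht_edge /= eqxx; apply/orP; right; apply/eqP; lia.
  have kn : (k.+1 < 2 * mval m e - 2)%N by lia.
  apply: (@card_edge_ge _ coord _ [:: Fq e (Ordinal kp); Fq e (Ordinal kn)]) => /=.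
    by rewrite inE andbT; apply/eqP => -[]; lia.
  rewrite andbT /frucht_edge /= !eqxx /= andbT.
  by apply/orP; right; apply/eqP; lia.
Qed.

Lemma card_edge_ge_r e (l : 'I_(2 * mval m e - 1)) :
  (capped_degree (Fr e l) <= #|fedge (Fr e l)|)%N.
Proof.
rewrite /=.
- have := mval_ge2 e; have := ltn_ord l => kb m2.
  case: ifP => [/eqP k0|/eqP k0].
    have r1 : (1 < 2 * mval m e - 1)%N by lia.
    have q0 : (0 < 2 * mval m e - 2)%N by lia.
    apply: (@card_edge_ge _ coord _ [:: Fp (tgt e); Fq e (Ordinal q0); Fr e (Ordinal r1)]).
      by [].
    by rewrite /= /frucht_edge /= k0 !eqxx.
  have kp : (l.-1 < 2 * mval m e - 1)%N by lia.
  case: ifP => [/eqP t0|/eqP t0].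
    apply: (@card_edge_ge _ coord _ [:: Fr e (Ordinal kp)]) => //=.
    by rewrite andbT /frucht_edge /= eqxx; apply/orP; right; apply/eqP; lia.
  have kn : (l.+1 < 2 * mval m e - 1)%N by lia.
  apply: (@card_edge_ge _ coord _ [:: Fr e (Ordinal kp); Fr e (Ordinal kn)]) => /=.
    by rewrite inE andbT; apply/eqP => -[]; lia.
  rewrite andbT /frucht_edge /= !eqxx /= andbT.
  by apply/orP; right; apply/eqP; lia.
Qed.

Lemma card_edge_ge_capped x : (2 < n)%N -> (capped_degree x <= #|fedge x|)%N.
Proof.
move=> n3; case: x => [i|e k|e l].
- exact: card_edge_ge_p.
- exact: card_edge_ge_q.
- exact: card_edge_ge_r.
Qed.

Lemma capped_degree_p x : is_p x = (capped_degree x == 4%N).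
Proof. by case: x => [//|e k|e l] /=; do 2!case: ifP => //. Qed.

Lemma capped_degree_nonp_le3 x : ~~ is_p x -> (capped_degree x <= 3)%N.
Proof. by case: x => [//|e k|e l] _ /=; do 2!case: ifP => //. Qed.

Lemma card_edge_neq x y : (2 < n)%N -> capped_degree x != capped_degree y ->
  #|fedge x| != #|fedge y|.
Proof.
move=> n3.
have gx := card_edge_ge_capped x n3; have gy := card_edge_ge_capped y n3.
have := @card_edge_nonp x; have := @card_edge_nonp y.
have := @capped_degree_nonp_le3 x; have := @capped_degree_nonp_le3 y.
case: (boolP (is_p x)); case: (boolP (is_p y)); rewrite !capped_degree_p.
- by move=> /eqP -> /eqP ->.
- by move=> yp /eqP xp /(_ isT) ? _ /(_ isT) ? _ _; lia.
- by move=> /eqP yp xp _ /(_ isT) ? _ /(_ isT) ? _; lia.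
- by move=> _ _ _ _ /(_ isT) ? /(_ isT) ? ?; lia.
Qed.

Lemma tail_edge_le x y : ~~ is_p x -> ~~ is_p y -> fedge x y ->
  (tail x <= (tail y).+1)%N.
Proof.
case: x => [//|e k|e l] _ yp; have m2 := mval_ge2 e.
- have kb := ltn_ord k.
  move=> /q_neighbour [[yE _]|[l [-> k0 l0]]|[k' [-> kk]]] /=.
  + by rewrite yE in yp.
  + by lia.
  + by have := ltn_ord k'; lia.
- have kb := ltn_ord l.
  move=> /r_neighbour [[yE _]|[k [-> k0 l0]]|[k' [-> kk]]] /=.
  + by rewrite yE in yp.
  + by lia.
  + by have := ltn_ord k'; lia.
Qed.

Lemma tail_next x s : ~~ is_p x -> tail x = s.+1 ->
  exists y, [/\ fedge x y, ~~ is_p y & tail y = s].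
Proof.
case: x => [//|e k|e l] _ /= t.
- have kn : (k.+1 < 2 * mval m e - 2)%N by lia.
  by exists (Fq e (Ordinal kn)); split; rewrite /frucht_edge //= ?eqxx //; lia.
- have kn : (l.+1 < 2 * mval m e - 1)%N by lia.
  by exists (Fr e (Ordinal kn)); split; rewrite /frucht_edge //= ?eqxx //; lia.
Qed.

Lemma capped_degree_tail0 x : ~~ is_p x -> tail x = 0%N -> capped_degree x = 1%N.
Proof.
case: x => [//|e k|e l] _ /= t; rewrite t eqxx; have := mval_ge2 e.
- by case: eqP => // k0; lia.
- by case: eqP => // k0; lia.
Qed.

Lemma capped_degree_tail_gt0 x : (0 < tail x)%N -> capped_degree x != 1%N.
Proof. by case: x => [//|e k|e l] /=; rewrite lt0n => /negbTE ->; case: ifP. Qed.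

Lemma act_tail h x : tail (act h x) = tail x.
Proof. by case: x => [//|e k|e l] /=; rewrite -mval_shift. Qed.

Lemma act_capped_degree h x : capped_degree (act h x) = capped_degree x.
Proof. by case: x => [//|e k|e l] /=; rewrite -mval_shift. Qed.

(** This is where the numbers m i j matter: at p_i, the tails 2m - 3 and 2m - 2 of
   the neighbours tell the arcs apart and, by parity, outgoing arcs from
   incoming ones. The degree is needed as well: the neighbours q_ij1 and r_ij2
   of r_ij1 have the same tail. *)
Lemma coloured_neighbour_unique x y z : fedge x y -> fedge x z ->
  capped_degree y = capped_degree z -> tail y = tail z -> y = z.
Proof.
case: x => [i|e k|e l].
- move=> /p_neighbour [] [e [k [-> se k0]]] /p_neighbour [] [e' [k' [-> se' k0']]] /=;
    have m2 := mval_ge2 e; have m2' := mval_ge2 e'; move=> _ t.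
  + have ee : e = e' by apply: mval_src_inj; [lia|rewrite se se'].
    by subst e'; apply: Fq_eq; rewrite k0 k0'.
  + by lia.
  + by lia.
  + have ee : e = e' by apply: mval_tgt_inj; [lia|rewrite se se'].
    by subst e'; apply: Fr_eq; rewrite k0 k0'.
- have m2 := mval_ge2 e; have kb := ltn_ord k.
  move=> /q_neighbour [[-> k0]|[l [-> k0 l0]]|[a [-> ka]]];
  move=> /q_neighbour [[-> k0']|[l' [-> k0' l0']]|[b [-> kb']]] //=;
    try (have := ltn_ord a); try (have := ltn_ord b).
  + by case: ifP => //; case: ifP.
  + by case: ifP => //; case: ifP.
  + by case: ifP => //; case: ifP.
  + by move=> _ _; apply: Fr_eq; lia.
  + by move=> _ _ t; lia.
  + by case: ifP => //; case: ifP.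
  + by move=> _ _ t; lia.
  + by move=> hb ha _ t; apply: Fq_eq; lia.
- have m2 := mval_ge2 e; have kb := ltn_ord l.
  move=> /r_neighbour [[-> k0]|[k [-> k0 l0]]|[a [-> ka]]];
  move=> /r_neighbour [[-> k0']|[k' [-> k0' l0']]|[b [-> kb']]] //=;
    try (have := ltn_ord a); try (have := ltn_ord b).
  + by case: ifP => //; case: ifP.
  + by case: ifP => //; case: ifP.
  + by case: ifP => //; case: ifP.
  + by move=> _ _; apply: Fq_eq; lia.
  + have -> : (b == 0 :> nat) = false by apply/eqP; lia.
    by rewrite l0 eqxx; case: ifP.
  + by case: ifP => //; case: ifP.
  + have -> : (a == 0 :> nat) = false by apply/eqP; lia.
    by rewrite l0' eqxx; case: ifP.
  + by move=> hb ha _ t; apply: Fr_eq; lia.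
Qed.

(** * Frucht graphs: the quantum automorphisms *)

Lemma frucht_connected_ind (P : vertex -> Prop) i0 : P (Fp i0) ->
  (forall x y, fedge x y -> P x -> P y) -> forall x, P x.
Proof.
move=> P0 step.
have q0 e : (0 < 2 * mval m e - 2)%N by have := mval_ge2 e; lia.
have r0 e : (0 < 2 * mval m e - 1)%N by have := mval_ge2 e; lia.
have toq e : P (Fp (src e)) -> P (Fq e (Ordinal (q0 e))).
  by apply: step; rewrite /frucht_edge /= !eqxx.
have tor e : P (Fp (src e)) -> P (Fr e (Ordinal (r0 e))).
  by move/toq; apply: step; rewrite /frucht_edge /= !eqxx.
have Pp i : P (Fp i).
  case: (eqVneq i0 i) => [<- //|ii].
  pose e : offdiag n := exist _ (i0, i) ii.
  have /tor : P (Fp (src e)) by [].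
  by apply: step; rewrite /frucht_edge /= !eqxx.
case=> [//|e k|e l].
- case: k; elim=> [|k IH] kb.
    by rewrite (@Fq_eq e _ (Ordinal (q0 e))) //; apply: toq.
  by apply: step (IH (ltnW kb)); rewrite /frucht_edge /= !eqxx.
- case: l; elim=> [|k IH] kb.
    by rewrite (@Fr_eq e _ (Ordinal (r0 e))) //; apply: tor.
  by apply: step (IH (ltnW kb)); rewrite /frucht_edge /= !eqxx.
Qed.

Section Quantum.
Variable R : realType.
Hypothesis n3 : (2 < n)%N.
Local Notation FG := (SGraph (@frucht_edge_sym n m) (@frucht_edge_irr n m)).

Lemma frucht_degree (B : cstarAlgType R) (v : FG -> FG -> B) (x y : FG) :
  qut_relations v -> capped_degree x != capped_degree y -> v x y = 0.
Proof. by move=> rv d; apply: (qut_degree rv); exact: card_edge_neq. Qed.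

(** The tails are recovered by successive refinement starting from the ends of
   the paths, which are the vertices of degree 1. *)
Lemma frucht_tail_lt (B : cstarAlgType R) s (v : FG -> FG -> B) (x y : FG) :
  qut_relations v -> ~~ is_p x -> ~~ is_p y -> tail x = s -> (s < tail y)%N ->
  v x y = 0.
Proof.
move=> rv; elim: s x y => [|s IH] x y xp yp tx ty.
  apply: frucht_degree => //; rewrite (capped_degree_tail0 xp tx) eq_sym.
  exact: capped_degree_tail_gt0.
have [k [xk kp tk]] := tail_next xp tx.
apply: (qut_refine rv xk) => l yl.
case: (boolP (is_p l)) => lp.
  apply: frucht_degree => //; move: kp lp; rewrite !capped_degree_p.
  by move=> kp /eqP ->.
by apply: IH => //; have := tail_edge_le yp lp yl; lia.
Qed.

Lemma frucht_colour (B : cstarAlgType R) (v : FG -> FG -> B) (x y : FG) :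
  qut_relations v ->
  ~~ ((capped_degree x == capped_degree y) && (tail x == tail y)) -> v x y = 0.
Proof.
move=> rv; case: eqP => [d|/eqP d _]; last exact: frucht_degree.
case: ltngtP => //= t _.
  have yp : ~~ is_p y by case: (y : vertex) t.
  have xp : ~~ is_p x by rewrite capped_degree_p d -capped_degree_p.
  exact: frucht_tail_lt t.
have xp : ~~ is_p x by case: (x : vertex) t.
have yp : ~~ is_p y by rewrite capped_degree_p -d -capped_degree_p.
exact: (frucht_tail_lt (qut_transpose rv) yp xp erefl t).
Qed.

Lemma frucht_no_quantum_symmetry : no_quantum_symmetry R FG.
Proof.
have i0 : 'I_n by apply: (Ordinal (ltnW (ltnW n3))).
apply: (@no_quantum_symmetry_of_free_action R gT FG act (Fp i0)).
- exact: act_inj.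
- exact: act_edge.
- exact: act_free.
move=> B v rv.
have sum1 : \sum_h v (Fp i0) (act h (Fp i0)) = 1.
  have [_ /(_ (Fp i0 : FG)) [<- _] _] := rv.
  rewrite /= (sum_shift (fun j => v (Fp i0) (Fp j))).
  rewrite [RHS](bigID is_p) /= [X in _ + X]big1 ?addr0; last first.
    move=> y yp; apply: frucht_degree => //.
    by rewrite capped_degree_p eq_sym in yp.
  rewrite (reindex_onto (fun j => Fp j : FG)
    (fun y : FG => if (y : vertex) is Fp j then j else i0)) /=.
    by apply: eq_bigl => j; rewrite eqxx.
  by case.
split=> //.
apply: (@frucht_connected_ind _ i0) => [//|x y xy known] h.
rewrite -(known h); apply: (qut_propagate rv _ _ xy).
- exact: act_edge.
- exact: act_free.
- by rewrite -sum1; apply: eq_bigr => k _; apply: known.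
move=> k z xz zy; apply: frucht_colour => //; apply: contra zy.
move=> /andP [/eqP d /eqP t]; apply/eqP.
apply: (coloured_neighbour_unique xz).
- by rewrite act_edge.
- by rewrite act_capped_degree.
by rewrite act_tail.
Qed.

End Quantum.

(** * Complete graphs on at most two vertices *)

Lemma sum_two_points (V : zmodType) (F : 'I_n -> V) i j :
  (n <= 2)%N -> i != j -> \sum_l F l = F i + F j.
Proof.
move=> n2 ij; rewrite (bigD1 i) //= (bigD1 j) 1?eq_sym //= big1 ?addr0 // => l.
move=> /andP [li lj]; have /uniq_leq_size us : uniq [:: l; i; j].
  by rewrite /= !inE negb_or li lj ij.
have := us (enum 'I_n) (fun a _ => mem_enum _ a).
by rewrite -cardE card_ord /= leqNgt ltnS n2.
Qed.

(** On two points, a row and a column of a magic unitary through the same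
   entry have the same complementary entry. *)
Lemma complete_no_quantum_symmetry (R : realType) : (n <= 2)%N ->
  no_quantum_symmetry R (complete_graph n).
Proof.
move=> n2.
apply: (@no_quantum_symmetry_of_free_action R gT (complete_graph n) shift (ginv 1%g)).
- exact: shift_inj.
- by move=> h i j; rewrite /= /complete_edge /= (inj_eq (@shift_inj h)).
- exact: shift_free.
move=> B v [_ sv _]; set i0 := ginv 1%g; split.
  by rewrite (sum_shift (v i0)); have [] := sv i0.
move=> i h; case: (eqVneq i i0) => [-> //|ii0].
have ne : shift h i != shift h i0 by rewrite (inj_eq (@shift_inj h)).
have [row _] := sv i0; have [_ col] := sv (shift h i).
apply: (addIr (v i0 (shift h i))).
rewrite -(sum_two_points (fun l => v l (shift h i)) n2 ii0) col -row.
by rewrite addrC; apply: sum_two_points.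
Qed.

End Frucht.

Theorem theorem8p4 (R : realType) (gT : finGroupType) (n : nat)
    (g : 'I_n -> gT) (m : 'I_n -> 'I_n -> nat) (g_bij : bijective g)
    (m_adm : frucht_admissible g m) :
  no_quantum_symmetry R (frucht_graph m).
Proof.
have [ginv gK ginvK] := g_bij.
rewrite /frucht_graph; case: leqP => [n2|n3].
  exact: complete_no_quantum_symmetry gK ginvK R n2.
exact: frucht_no_quantum_symmetry gK ginvK m_adm R n3.
Qed.
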